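(* Let $G$ be a finite simple $d$-regular Vizing-class-2 graph that admits a spaced $(d+1)$-edge-coloring. Then $\eta_p'(G)\leq 2d=2\chi'(G)-2$.
   Context: A $d$-regular graph is Vizing-class-2 if its chromatic index $\chi'(G)$ equals $d+1$. For edges $e,e'$, $e'$ is 2-reachable from $e$ if there is a path of length two (three distinct vertices) from an endpoint of $e$ to an endpoint of $e'$. A spaced $(d+1)$-edge-coloring is a proper edge coloring $c:E(G)\to\{1,\dots,d+1\}$ such that whenever $c(e)=c(e')=d+1$ (including $e=e'$), $e'$ is not 2-reachable from $e$. For an edge $e$, $N'(e)$ is the set of edges other than $e$ sharing an endpoint with $e$. $\eta_p'(G)$ is the least $k$ such that there is a proper edge coloring $c:E(G)\to\{1,\dots,k\}$ with $\sum_{e\in N'(e_1)}c(e)\neq\sum_{e\in N'(e_2)}c(e)$ for every two edges $e_1,e_2$ sharing an endpoint. *)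

(* Defs.v *)
From mathcomp Require Import all_boot.

Set Implicit Arguments.
Unset Strict Implicit.
Unset Printing Implicit Defensive.

Record sgraph := SGraph {
  vertex :> finType;
  adj : rel vertex;
  adj_sym : symmetric adj;
  adj_irrefl : irreflexive adj }.

Section Defs.
Variable G : sgraph.

Definition regular (d : nat) : Prop := forall x : G, #|[set y | adj x y]| = d.

Definition edges : {set {set G}} :=
  [set f : {set G} | [exists x, exists y, adj x y && (f == [set x; y])]].

(* N'(f) *)
Definition edge_nbhd (f : {set G}) : {set {set G}} :=
  [set g in edges | (g != f) && (f :&: g != set0)].

(* Colorings are nat-valued functions on all vertex sets; only their values on
   [edges] matter, and these range over 1, ..., k. *)
Definition proper_edge_coloring (k : nat) (c : {set G} -> nat) : bool :=
  [forall f in edges, 0 < c f <= k] &&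
  [forall f in edges, forall g in edge_nbhd f, c f != c g].

Definition nbhd_sum (c : {set G} -> nat) (f : {set G}) : nat :=
  \sum_(g in edge_nbhd f) c g.

Definition sum_distinguishing (c : {set G} -> nat) : bool :=
  [forall f in edges, forall g in edge_nbhd f, nbhd_sum c f != nbhd_sum c g].

(* The finite function type makes existence of a coloring a boolean; see
   [edge_colorableP] and [eta_colorableP]. *)
Definition edge_colorable (k : nat) : bool :=
  [exists c : {ffun {set G} -> 'I_k.+1},
     proper_edge_coloring k (fun f => c f)].

Definition eta_colorable (k : nat) : bool :=
  [exists c : {ffun {set G} -> 'I_k.+1},
     proper_edge_coloring k (fun f => c f) && sum_distinguishing (fun f => c f)].

Lemma edge_nbhd_edge f g : g \in edge_nbhd f -> g \in edges.
Proof. by rewrite inE => /andP[]. Qed.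

Lemma eq_in_proper k (c c' : {set G} -> nat) :
  {in edges, c =1 c'} -> proper_edge_coloring k c -> proper_edge_coloring k c'.
Proof.
move=> cc' /andP[/forall_inP c1 /forall_inP c2]; apply/andP; split.
  by apply/forall_inP => f fE; rewrite -cc' // c1.
apply/forall_inP => f fE; apply/forall_inP => g gf.
by rewrite -!cc' ?(edge_nbhd_edge gf) //; apply: (forall_inP (c2 f fE)).
Qed.

Lemma eq_in_sum (c c' : {set G} -> nat) :
  {in edges, c =1 c'} -> sum_distinguishing c -> sum_distinguishing c'.
Proof.
move=> cc' /forall_inP c2; apply/forall_inP => f fE; apply/forall_inP => g gf.
have e h : nbhd_sum c' h = nbhd_sum c h.
  by apply: eq_bigr => x /edge_nbhd_edge /cc'.
by rewrite !e; apply: (forall_inP (c2 f fE)).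
Qed.

Lemma trunc_coloring k (c : {set G} -> nat) : proper_edge_coloring k c ->
  {in edges, c =1 (fun f => [ffun g => inord (c g) : 'I_k.+1] f)}.
Proof.
move=> /andP[/forall_inP c1 _] f fE; rewrite ffunE inordK // ltnS.
by case/andP: (c1 f fE).
Qed.

Lemma edge_colorableP k :
  reflect (exists c, proper_edge_coloring k c) (edge_colorable k).
Proof.
apply: (iffP existsP) => [[c pc]|[c pc]]; first by exists (fun f => val (c f)).
by exists [ffun f => inord (c f)]; exact: eq_in_proper (trunc_coloring pc) pc.
Qed.

Lemma eta_colorableP k :
  reflect (exists c, proper_edge_coloring k c && sum_distinguishing c)
          (eta_colorable k).
Proof.
apply: (iffP existsP) => [[c pc]|[c /andP[pc sc]]]; first by exists (fun f => val (c f)).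
exists [ffun f => inord (c f)]; apply/andP; split.
  exact: eq_in_proper (trunc_coloring pc) pc.
exact: eq_in_sum (trunc_coloring pc) sc.
Qed.

Lemma sum_pow2_lt n (P : pred nat) : \sum_(0 <= i < n | P i) 2 ^ i < 2 ^ n.
Proof.
elim: n => [|n IH]; first by rewrite big_geq.
rewrite big_mkcond big_nat_recr //= -big_mkcond /= expnS mul2n -addnn.
by rewrite -addSn leq_add // ; case: (P n).
Qed.

Lemma sum_pow2_rank (A : {set {set G}}) :
  \sum_(f in A) 2 ^ enum_rank f =
  \sum_(0 <= i < #|{set G}| | [exists f in A, enum_rank f == i :> nat]) 2 ^ i.
Proof.
rewrite big_mkord (reindex_onto (@enum_val _ _) (@enum_rank _)) /=; last first.
  by move=> f _; rewrite enum_rankK.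
apply: eq_big => [i|i _]; last by rewrite enum_valK.
rewrite enum_valK eqxx andbT; apply/idP/exists_inP => [iA|[f fA /eqP fi]].
  by exists (enum_val i); rewrite ?enum_valK.
by rewrite -(_ : f = enum_val i) //; apply: enum_rank_inj; rewrite enum_valK;
   apply: val_inj.
Qed.

Lemma sum_pow2_inj n (P Q : pred nat) :
  \sum_(0 <= i < n | P i) 2 ^ i = \sum_(0 <= i < n | Q i) 2 ^ i ->
  forall i, i < n -> P i = Q i.
Proof.
elim: n => // n IH; rewrite big_mkcond big_nat_recr //= -big_mkcond /=.
rewrite [RHS]big_mkcond big_nat_recr //= -big_mkcond /= => e.
have e' : P n = Q n.
  move: e; case: (P n) (Q n) => [] [] //; rewrite addn0 => e.
    by have := sum_pow2_lt n Q; rewrite -e ltnNge leq_addl.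
  by have := sum_pow2_lt n P; rewrite e ltnNge leq_addl.
move: e; rewrite e' => /addIn /IH {}IH i; rewrite ltnS leq_eqVlt.
by case/predU1P => [->|/IH].
Qed.

Lemma ex_eta_colorable : exists k, eta_colorable k.
Proof.
exists (2 ^ #|{set G}|); apply/eta_colorableP.
exists (fun f => 2 ^ enum_rank f); apply/andP; split; first (apply/andP; split).
- apply/forall_inP => f _; rewrite expn_gt0 /= leq_pexp2l //.
  exact/ltnW/ltn_ord.
- apply/forall_inP => f _; apply/forall_inP => g; rewrite inE => /and3P[_ gf _].
  rewrite eqn_exp2l //; apply: contra gf => /eqP /val_inj /enum_rank_inj ->.
  exact: eqxx.
apply/forall_inP => f fE; apply/forall_inP => g gf; apply/eqP.
rewrite /nbhd_sum !sum_pow2_rank => /sum_pow2_inj /(_ _ (ltn_ord (enum_rank g))).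
have -> : [exists h in edge_nbhd f, enum_rank h == enum_rank g :> nat].
  by apply/exists_inP; exists g.
move/esym => /exists_inP[h hg /eqP /val_inj /enum_rank_inj hE].
by move: hg; rewrite hE !inE eqxx andbF.
Qed.

Lemma ex_edge_colorable : exists k, edge_colorable k.
Proof.
have [k /eta_colorableP[c /andP[pc _]]] := ex_eta_colorable.
by exists k; apply/edge_colorableP; exists c.
Qed.

Definition chromatic_index : nat := ex_minn ex_edge_colorable.

Definition eta_p' : nat := ex_minn ex_eta_colorable.

Definition vizing_class2 (d : nat) : Prop := chromatic_index = d.+1.

Definition two_reachable (f g : {set G}) : Prop :=
  exists x y z : G, [/\ x \in f, z \in g, uniq [:: x; y; z], adj x y & adj y z].

Definition spaced_edge_coloring (d : nat) (c : {set G} -> nat) : Prop :=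
  proper_edge_coloring d.+1 c /\
  forall f g : {set G}, f \in edges -> g \in edges ->
    c f = d.+1 -> c g = d.+1 -> ~ two_reachable f g.

End Defs.

(* Main.v *)
Require Import Defs.
From mathcomp Require Import all_boot.
From mathcomp Require Import zify.

(** Recolor a spaced [(d+1)]-coloring [c] by sending each color [i <= d] to
    [2 i] and the special color [d+1] to [1].  Write [S v] for the sum of the
    new colors at [v]; the sum over the neighbors of an edge [uv] is
    [S u + S v - 2 c' uv].  Since special edges are not 2-reachable from one
    another, for two edges [uv], [uw] at most one of [v], [w] is covered by a
    special edge.  If exactly one is, then [S v] and [S w] have different
    parities; if none is, then both vertices see all colors [1, ..., d], so
    [S v = S w] and the two sums differ because [c'] is proper. *)

Section SpacedColorings.
Set Implicit Arguments.
Unset Strict Implicit.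
Variable G : sgraph.
Implicit Types (u v w : G) (f g : {set G}) (c : {set G} -> nat).

(** * Stars of vertices and sums over edge neighborhoods *)

Definition star v : {set {set G}} := [set f in edges G | v \in f].

(* [inE] would also unfold [edges]. *)
Lemma in_star v f : (f \in star v) = (f \in edges G) && (v \in f).
Proof. by rewrite inE. Qed.

Lemma in_edge_nbhd f g :
  (g \in edge_nbhd f) = [&& g \in edges G, g != f & f :&: g != set0].
Proof. by rewrite inE. Qed.

Definition star_sum c v : nat := \sum_(f in star v) c f.

Lemma edgeP f :
  reflect (exists u v, adj u v /\ f = [set u; v]) (f \in edges G).
Proof.
rewrite inE; apply: (iffP existsP) => [[u /existsP[v /andP[uv /eqP ->]]]|].
  by exists u, v.
by case=> u [v [uv ->]]; exists u; apply/existsP; exists v; rewrite uv eqxx.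
Qed.

Lemma adj_edge u v : adj u v -> [set u; v] \in edges G.
Proof. by move=> uv; apply/edgeP; exists u, v. Qed.

Lemma adj_neq u v : adj u v -> u != v.
Proof. by apply: contraTneq => ->; rewrite adj_irrefl. Qed.

Lemma starP v f : reflect (exists2 w, adj v w & f = [set v; w]) (f \in star v).
Proof.
rewrite in_star; apply: (iffP andP) => [[/edgeP[x [y [xy ->]]]]|[w vw ->]].
  rewrite !inE => /orP[]/eqP ->; first by exists y.
  by exists x; rewrite 1?adj_sym // setUC.
by rewrite adj_edge // !inE eqxx.
Qed.

Lemma set2_inj v : injective (fun w : G => [set v; w]).
Proof.
move=> x y /setP e; have [//|xy] := eqVneq x y.
have := e x; have := e y; rewrite !inE !eqxx !orbT [y == x]eq_sym (negPf xy).
by rewrite !orbF => /eqP -> /esym/eqP.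
Qed.

Lemma card_star d v : regular G d -> #|star v| = d.
Proof.
move=> /(_ v) <-; rewrite -(card_imset _ (@set2_inj v)); apply: eq_card => f.
apply/starP/imsetP => [[w vw ->]|[w]]; first by exists w; rewrite ?inE.
by rewrite inE => vw ->; exists w.
Qed.

Lemma edge_two_vertices u v f :
  u != v -> f \in edges G -> u \in f -> v \in f -> f = [set u; v].
Proof.
move=> uv fE uf vf.
have /starP[w uw e] : f \in star u by rewrite in_star fE.
by move: vf; rewrite e !inE eq_sym (negPf uv) => /eqP ->.
Qed.

(** The stars of [u] and [v] share only the edge [uv], and their other members are exactly its
    neighbors. The right side thus counts [uv] twice. *)
Lemma nbhd_sum_star c u v : adj u v ->
  nbhd_sum c [set u; v] + 2 * c [set u; v] = star_sum c u + star_sum c v.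
Proof.
move=> uv; set f := [set u; v].
have fu : f \in star u by apply/starP; exists v.
have fv : f \in star v by apply/starP; exists u; rewrite 1?adj_sym // /f setUC.
rewrite /star_sum (big_setD1 f fu) (big_setD1 f fv) /=.
suff -> : nbhd_sum c f =
    \sum_(g in star u :\ f) c g + \sum_(g in star v :\ f) c g.
  by rewrite addnACA [RHS]addnC mul2n -addnn.
rewrite /nbhd_sum -bigU /=.
  apply: eq_bigl => g; rewrite in_edge_nbhd [RHS]inE /= !in_setD1 !in_star.
  have -> : (f :&: g != set0) = (u \in g) || (v \in g).
    apply/set0Pn/orP => [[x]|[h|h]].
    - by rewrite !inE => /andP[/orP[]/eqP ->]; [left|right].
    - by exists u; rewrite !inE eqxx.
    - by exists v; rewrite !inE eqxx orbT.
  by case: (g \in _); case: (g == f).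
rewrite -setI_eq0; apply/eqP/setP => g.
rewrite in_setI !in_setD1 !in_star in_set0.
apply/negP => /andP[/and3P[gf gE ug] /and3P[_ _ vg]].
by rewrite (edge_two_vertices (adj_neq uv) gE ug vg) eqxx in gf.
Qed.

Lemma star_edge_nbhd v f g :
  f \in star v -> g \in star v -> g != f -> g \in edge_nbhd f.
Proof.
rewrite !in_star in_edge_nbhd => /andP[fE vf] /andP[gE vg] ->; rewrite gE /=.
by apply/set0Pn; exists v; rewrite inE vf.
Qed.

Lemma edge_nbhd_star f g : f \in edges G -> g \in edge_nbhd f ->
  exists u v w, [/\ adj u v, adj u w, v != w, f = [set u; v] & g = [set u; w]].
Proof.
move=> fE; rewrite in_edge_nbhd => /and3P[gE gf /set0Pn[u]].
rewrite inE => /andP[uf ug].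
have /starP[v uv ef] : f \in star u by rewrite in_star fE.
have /starP[w uw eg] : g \in star u by rewrite in_star gE.
exists u, v, w; split => //.
by apply: contraNneq gf => vw; rewrite ef eg vw.
Qed.

Lemma properP k c :
  reflect [/\ {in edges G, forall f, 0 < c f <= k} &
             {in edges G, forall f, {in edge_nbhd f, forall g, c f != c g}}]
          (proper_edge_coloring k c).
Proof.
apply: (iffP andP) => [[/forall_inP c1 /forall_inP c2]|[c1 c2]]; split => //.
- by move=> f fE; apply: (forall_inP (c2 f fE)).
- exact/forall_inP.
- by apply/forall_inP => f fE; apply/forall_inP; apply: c2.
Qed.

Lemma proper_star_inj k c v :
  proper_edge_coloring k c -> {in star v &, injective c}.
Proof.
move=> /properP[_ c2] f g fv gv e; apply/eqP; apply: contraT => fg.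
have fE : f \in edges G by move: fv; rewrite in_star => /andP[].
have := c2 f fE g; rewrite e eqxx; apply.
by apply: star_edge_nbhd fv gv _; rewrite eq_sym.
Qed.

(** * The recoloring and its star sums *)

Section Recolor.
Variables (d : nat) (c : {set G} -> nat).
Hypothesis regG : regular G d.
Hypothesis spaced_c : spaced_edge_coloring d c.

Definition recolor f := if c f == d.+1 then 1 else 2 * c f.

Definition covered v := [exists f in star v, c f == d.+1].

Let proper_c : proper_edge_coloring d.+1 c := proj1 spaced_c.

Lemma recolor_proper : proper_edge_coloring (2 * d) recolor.
Proof.
have /properP[c1 c2] := proper_c.
apply/properP; split => [f fE|f fE g gf].
  have := c1 f fE; rewrite /recolor; case: eqP => [_ _|]; last by lia.
  (* The new color 1 is at most [2 * d] only if [d] is positive; an endpoint of [f] has a neighbor,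
     so its degree [d] is. *)
  have /edgeP[u [v [uv _]]] := fE.
  suff : 0 < d by lia.
  by rewrite -(regG u) card_gt0; apply/set0Pn; exists v; rewrite inE.
have := c2 f fE g gf.
by rewrite /recolor; case: (c f =P d.+1); case: (c g =P d.+1); lia.
Qed.

(** Special edges at [v] and [w] would be joined by the path [v], [u], [w]. They may coincide: when
    [u], [v], [w] form a triangle, this also excludes a special edge [vw]. *)
Lemma covered_disjoint u v w :
  adj u v -> adj u w -> v != w -> covered v -> ~~ covered w.
Proof.
move=> uv uw vw /exists_inP[f fv /eqP cf].
apply/negP => /exists_inP[g gw /eqP cg].
move: fv gw; rewrite !in_star => /andP[fE vf] /andP[gE wg].
apply: (proj2 spaced_c f g fE gE cf cg).
exists v, u, w; split => //=; last by rewrite adj_sym.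
by rewrite !inE negb_or [v == u]eq_sym vw !adj_neq.
Qed.

(** The new color 1 is the only odd one, and properness of [c] allows at most one special edge at
    [v]. *)
Lemma odd_star_sum v : odd (star_sum recolor v) = covered v.
Proof.
rewrite /covered; case: exists_inP => [[f fv /eqP cf]|nc].
  rewrite /star_sum (big_setD1 f fv) /= {1}/recolor cf eqxx.
  rewrite (eq_bigr (fun g => 2 * c g)) => [|g].
    by rewrite -big_distrr /= oddD oddM.
  rewrite in_setD1 /recolor => /andP[gf gv]; case: eqP => // cg.
  by case/eqP: gf; apply: (proper_star_inj proper_c gv fv); rewrite cf.
rewrite /star_sum (eq_bigr (fun g => 2 * c g)) => [|g gv].
  by rewrite -big_distrr /= oddM.
by rewrite /recolor; case: eqP => // cg; case: nc; exists g; rewrite ?cg.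
Qed.

Lemma uncovered_star_sum v :
  ~~ covered v -> star_sum recolor v = \sum_(i <- iota 1 d) 2 * i.
Proof.
move=> nc.
have cNd f : f \in star v -> c f != d.+1.
  by move=> fv; apply: contra nc => cf; apply/exists_inP; exists f.
have perm : perm_eq [seq c f | f <- enum (star v)] (iota 1 d).
  have uc : uniq [seq c f | f <- enum (star v)].
    rewrite map_inj_in_uniq ?enum_uniq // => f g; rewrite !mem_enum.
    by move=> fv gv; apply: (proper_star_inj proper_c fv gv).
  apply: uniq_perm => //; first exact: iota_uniq.
  (* The [d] edges at [v] have distinct colors, all in [1, ..., d], so by counting every one of
     these colors occurs. *)
  apply: (snd (uniq_min_size uc _ _)) => [i|].
    case/mapP => f; rewrite mem_enum => fv ->; rewrite mem_iota.
    have := cNd f fv; move: fv; rewrite in_star => /andP[fE _].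
    by have /properP[/(_ f fE) c1 _] := proper_c; lia.
  by rewrite size_iota size_map -cardE (card_star _ regG).
rewrite -(perm_big _ perm) /= big_map big_enum /=.
by apply: eq_bigr => f fv; rewrite /recolor (negPf (cNd f fv)).
Qed.

Lemma recolor_sum_distinguishing : sum_distinguishing recolor.
Proof.
apply/forall_inP => f fE; apply/forall_inP => g gf; apply/eqP => e.
have /properP[_ /(_ f fE g gf)] := recolor_proper.
have [u [v [w [uv uw vw ef eg]]]] := edge_nbhd_star fE gf.
have := nbhd_sum_star recolor uv; have := nbhd_sum_star recolor uw.
(* Subtracting the two equations gives [S v - S w = 2 (c' f - c' g)], with [S] the star sum and [c']
   the new coloring. So [S v] and [S w] have equal parity, and [S v = S w] would force
   [c' f = c' g]. *)
rewrite -ef -eg -e.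
have ov := odd_star_sum v; have ow := odd_star_sum w.
have := covered_disjoint uv uw vw.
case cv: (covered v) ov => ov; case cw: (covered w) ow => ow //=.
- by move/(_ isT).
- by lia.
- by lia.
- have : star_sum recolor v = star_sum recolor w.
    by rewrite !uncovered_star_sum ?cv ?cw.
  by lia.
Qed.

End Recolor.

End SpacedColorings.

Theorem theorem2p9 (G : sgraph) (d : nat) :
  regular G d -> vizing_class2 G d ->
  (exists c : {set G} -> nat, spaced_edge_coloring d c) ->
  eta_p' G <= 2 * d /\ 2 * d = 2 * chromatic_index G - 2.
Proof.
move=> regG class2 [c spaced_c]; split; last by rewrite class2; lia.
(* By minimality of [eta_p'], one suitable coloring with [2 * d] colors is enough. *)
rewrite /eta_p'; case: ex_minnP => k _; apply; apply/eta_colorableP.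
exists (recolor d c).
by rewrite recolor_proper ?recolor_sum_distinguishing.
Qed.
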